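(* Up to isomorphism, there are: (i) $6$ convex geometries on three elements, of which $1$ is primitive and non-ordinal, and $5$ are resolvable and ordinal; (ii) $34$ convex geometries on four elements, $12$ of which are primitive; among the primitive ones, $1$ is ordinal and $2$ are affine.
   Context: A convex geometry on a finite nonempty set $X$ is a family $\mathcal{G}\subseteq 2^X$ such that: (G1) $\varnothing\in\mathcal{G}$; (G2) if $F,G\in\mathcal{G}$ then $F\cap G\in\mathcal{G}$; (G3) for every $G\in\mathcal{G}\setminus\{X\}$ there is $x\in X\setminus G$ with $G\cup\{x\}\in\mathcal{G}$. The pair $(X,\mathcal{G})$ is also called a convex geometry. For $A\subseteq X$, the convex hull is $\operatorname{conv}_{\mathcal{G}}(A)=\bigcap\{G\in\mathcal{G}: A\subseteq G\}$, and the set of extreme elements of $A$ is $\operatorname{ex}_{\mathcal{G}}(A)=\{a\in A: a\notin\operatorname{conv}_{\mathcal{G}}(A\setminus\{a\})\}$. Two convex geometries $(X,\mathcal{G}_X)$, $(Y,\mathcal{G}_Y)$ are isomorphic if there is a bijection $\sigma\colon X\to Y$ with $A\in\mathcal{G}_X\iff\sigma(A)\in\mathcal{G}_Y$ for all $A\subseteq X$. A convex geometry $(X,\mathcal{G})$ is ordinal if there is a partial order $\le$ on $X$ such that $\mathcal{G}$ is the family of all ideals of $(X,\le)$, i.e. all $G\subseteq X$ such that $x\le y$ and $y\in G$ imply $x\in G$. A convex geometry is affine if it is isomorphic to one of the form $(X,\{X\cap C: C\text{ a convex subset of }\mathbb{R}^d\})$ for some $d$ and some nonempty finite $X\subset\mathbb{R}^d$.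 Resolution: let $(X,\mathcal{G}_X)$ be a convex geometry (the base) and $\{(Y_x,\mathcal{G}_x):x\in X\}$ a family of convex geometries (the fibers), where the sets $Y_x$ are pairwise disjoint and disjoint from $X$. Let $Z=\bigcup_{x\in X}Y_x$ and let $\pi\colon Z\to X$ be the projection given by $\pi(z)=x$ for $z\in Y_x$. The resolution of $(X,\mathcal{G}_X)$ into $\{(Y_x,\mathcal{G}_x):x\in X\}$ is the pair $(Z,\mathcal{G}_Z)$, where $\mathcal{G}_Z$ consists of all $A\subseteq Z$ such that: (R1) $\pi(A)\in\mathcal{G}_X$; (R2) $A\cap Y_x\in\mathcal{G}_x$ for all $x\in\pi(A)$; (R3) $Y_x\subseteq A$ for all $x\in\pi(A)\setminus\operatorname{ex}_{\mathcal{G}_X}(\pi(A))$. The resolution is again a convex geometry. It is nontrivial if both the base and at least one fiber have more than one element. A convex geometry is resolvable if it equals some nontrivial resolution of convex geometries, and primitive otherwise. *)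

(* Defs.v *)
From mathcomp Require Import all_boot all_order all_algebra finmap.
From mathcomp Require Import boolp classical_sets reals convex.
(* finset is imported last so that set0, setT, ... denote finite sets. *)
From mathcomp Require Import finset.

Set Implicit Arguments.
Unset Strict Implicit.
Unset Printing Implicit Defensive.

Local Open Scope set_scope.

Definition convex_geometry (X : finType) (G : {set {set X}}) : bool :=
  [&& 0 < #|X|,
      set0 \in G,
      [forall A in G, forall B in G, A :&: B \in G]
    & [forall A in G, (A != setT) ==>
        [exists x, (x \notin A) && (x |: A \in G)]]].

Definition conv_hull (X : finType) (G : {set {set X}}) (A : {set X}) :=
  \bigcap_(B in G | A \subset B) B.

Definition extreme (X : finType) (G : {set {set X}}) (A : {set X}) :=
  [set a in A | a \notin conv_hull G (A :\ a)].

Definition isomorphic (X Y : finType)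
    (G : {set {set X}}) (H : {set {set Y}}) : Prop :=
  exists2 s : X -> Y, bijective s &
    forall A : {set X}, (A \in G) = (s @: A \in H).

Definition is_ordinal (X : finType) (G : {set {set X}}) : Prop :=
  exists2 le : rel X, [/\ reflexive le, antisymmetric le & transitive le] &
    G = [set A : {set X} | [forall x, forall y, le x y && (y \in A) ==> (x \in A)]].

Definition affine_geometry (R : realType) (d : nat) (P : {fset 'rV[R]_d}) :
    {set {set P}} :=
  [set A : {set P} |
    `[< exists2 C : set (convex_lmodType 'rV[R]_d),
          convex_set C & A = [set p : P | val p \in C] >]].

Definition is_affine (R : realType) (X : finType) (G : {set {set X}}) : Prop :=
  exists (d : nat) (P : {fset 'rV[R]_d}),
    P != fset0 /\ isomorphic G (affine_geometry P).

(* The disjoint union of the fibers is the tagged type {x : X & Y x}, whose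
   projection to X is tag; a point y of the fiber Y x is Tagged Y y, so that
   [set y | Tagged Y y \in A] is the trace of A on Y x, viewed as a subset of Y x. *)
Definition resolution (X : finType) (Y : X -> finType)
    (GX : {set {set X}}) (GY : forall x, {set {set Y x}}) :
    {set {set {x : X & Y x}}} :=
  [set A : {set {x : X & Y x}} |
    let piA := tag @: A in
    [&& piA \in GX,
        [forall x in piA, [set y : Y x | Tagged Y y \in A] \in GY x]
      & [forall x in piA :\: extreme GX piA,
          forall y : Y x, Tagged Y y \in A]]].

(* Since disjoint unions are tagged types, a geometry on an arbitrary finite
   type Z can equal a resolution only after Z has been identified with the
   disjoint union of the fibers; hence the isomorphism. *)
Definition is_resolvable (Z : finType) (G : {set {set Z}}) : Prop :=
  exists (X : finType) (Y : X -> finType)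
         (GX : {set {set X}}) (GY : forall x, {set {set Y x}}),
    [/\ convex_geometry GX,
        forall x, convex_geometry (GY x),
        1 < #|X|,
        exists x, 1 < #|Y x|
      & isomorphic G (resolution GX GY)].

Definition is_primitive (Z : finType) (G : {set {set Z}}) : Prop :=
  ~ is_resolvable G.

(* The number of isomorphism classes of convex geometries on n elements that
   contain a geometry with the property P. *)
Definition nb_classes (n : nat) (P : {set {set 'I_n}} -> Prop) : nat :=
  #|equivalence_partition
      (fun G H : {set {set 'I_n}} => `[< isomorphic G H >])
      [set G | convex_geometry G && `[< P G >]]|.
Arguments nb_classes n P : clear implicits.

(* Main.v *)
Require Import Defs.
From mathcomp Require Import all_boot all_order all_algebra finmap.
From mathcomp Require Import boolp classical_sets reals convex.
From mathcomp Require Import interval_inference ring lra.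
(* Imported last so that subsetP, subset_trans, ... speak of finite sets. *)
From mathcomp Require Import fintype finset.

(** The proposition is a census: the isomorphism classes on three and four
    elements are listed exhaustively, and each property is decided on every
    class. What makes this a finite computation is that each of the properties
    involved, although defined by quantifying over arbitrary types, orders or
    point configurations, has a criterion that only looks at the closed sets.

    Ordinality: a convex geometry is ordinal exactly when its closed sets are
    stable under union ([is_ordinalP]).

    Resolvability: a convex geometry on Z is a nontrivial resolution exactly
    when some M with 1 < #|M| < #|Z| is autonomous, that is, behaves like a
    single point as seen from outside ([is_resolvableP]). A fiber with more
    than one element is autonomous ([fiber_autonomous]). Conversely, collapsing
    an autonomous set to a point presents the geometry as a resolution with M
    as its only nontrivial fiber ([autonomous_resolvable]).

    Affineness: write c in [a, b] when every closed set containing a and b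
    contains c. In an affine geometry this is membership in a straight segment,
    so [a, a] = {a}; no e outside {a, b, c} lies in [a, b], [a, c] and [b, c] at
    once; and c in [a, b], e in [a, c] imply c in [e, b]
    ([affine_segment_axioms]). These necessary conditions leave only two
    primitive geometries on four elements: the intervals of four points on a
    line and a triangle with an interior point, both of which are affine
    ([interval_geometry_affine], [triangle_geometry_affine]).

    The enumeration encodes subsets of 'I_n as bit sequences. By the extension
    axiom every convex geometry has a maximal chain of closed sets that grows by
    one element at a time; relabelling along it, one may assume that all initial
    segments are closed ([chained_relabelling]). This leaves a search small
    enough to be evaluated ([chained_geometries]), whose results are then
    thinned out to one representative per isomorphism class
    ([classificationP]). *)

Set Implicit Arguments.
Unset Strict Implicit.
Unset Printing Implicit Defensive.

Local Open Scope set_scope.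

(** * Isomorphism and counting classes *)

Lemma imset_bij (X Y : finType) (s : X -> Y) (t : Y -> X) (A : {set X}) :
  cancel s t -> cancel t s -> s @: A = t @^-1: A.
Proof.
move=> sK tK; apply/setP=> y; rewrite inE; apply/imsetP/idP.
  by case=> x xA ->; rewrite sK.
by move=> tyA; exists (t y); rewrite ?tK.
Qed.

Lemma isomorphicP (X Y : finType) (G : {set {set X}}) (H : {set {set Y}}) :
  isomorphic G H <->
  exists2 s : Y -> X, bijective s & forall A, (A \in G) = (s @^-1: A \in H).
Proof.
split=> -[s [t sK tK] GH].
  exists t; first by exists s.
  by move=> A; rewrite GH (imset_bij _ sK tK).
exists t; first by exists s.
by move=> A; rewrite GH (imset_bij _ tK sK).
Qed.

Lemma isomorphic_refl (X : finType) (G : {set {set X}}) : isomorphic G G.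
Proof. by exists id; [exists id | move=> A; rewrite imset_id]. Qed.

Lemma isomorphic_sym (X Y : finType) (G : {set {set X}}) (H : {set {set Y}}) :
  isomorphic G H -> isomorphic H G.
Proof.
case=> s [t sK tK] GH; apply/isomorphicP; exists s; first by exists t.
move=> A; rewrite GH (imset_bij _ sK tK).
by congr (_ \in H); apply/setP=> y; rewrite !inE tK.
Qed.

Lemma isomorphic_trans (X Y Z : finType) (G : {set {set X}})
    (H : {set {set Y}}) (K : {set {set Z}}) :
  isomorphic G H -> isomorphic H K -> isomorphic G K.
Proof.
case=> s sbij GH [t tbij HK]; exists (t \o s); first exact: bij_comp.
by move=> A; rewrite GH HK imset_comp.
Qed.

(** A system of distinct representatives for the classes may be replaced by any
    list of pairwise non-isomorphic geometries that meets every class. *)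
Lemma nb_classesE n (P : {set {set 'I_n}} -> Prop) (L : seq {set {set 'I_n}}) :
    uniq L -> {in L &, forall G H, isomorphic G H -> G = H} ->
    {in L, forall G, convex_geometry G /\ P G} ->
    (forall G, convex_geometry G -> P G -> exists2 H, H \in L & isomorphic G H) ->
  nb_classes n P = size L.
Proof.
move=> uL Linj LP Lfull; rewrite /nb_classes /equivalence_partition.
set D := [set G | _].
pose cl (G : {set {set 'I_n}}) := [set H in D | `[< isomorphic G H >]].
have LD G : G \in L -> G \in D.
  by move=> /LP[cG PG]; rewrite inE cG; apply/asboolP.
have -> : [set cl G | G in D] = cl @: [set G in L].
  apply/setP=> C; apply/imsetP/imsetP=> -[G GD ->]; last first.
    by exists G => //; apply: LD; rewrite inE in GD.
  have /andP[cG /asboolP PG] : convex_geometry G && `[< P G >] by rewrite inE in GD.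
  have [H HL GH] := Lfull G cG PG.
  exists H; first by rewrite inE.
  apply/setP=> K; rewrite !inE; congr (_ && _); apply/asboolP/asboolP.
    exact/isomorphic_trans/isomorphic_sym.
  exact: isomorphic_trans.
rewrite card_in_imset; first by rewrite cardsE; apply/card_uniqP.
move=> G H; rewrite !inE => GL HL eqcl; apply: Linj => //.
have : H \in cl H by rewrite inE LD //; apply/asboolP/isomorphic_refl.
by rewrite -eqcl inE => /andP[_ /asboolP].
Qed.

(** * Closed sets of a convex geometry *)

Lemma convex_geometryP (X : finType) (G : {set {set X}}) :
  reflect [/\ 0 < #|X|, set0 \in G, {in G &, forall A B, A :&: B \in G}
            & forall A, A \in G -> A != setT ->
                exists2 x, x \notin A & x |: A \in G]
          (convex_geometry G).
Proof.
apply: (iffP and4P) => -[X0 G0 GI GS]; split=> //.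
- by move=> A B AG BG; have /forall_inP/(_ B BG) := forall_inP GI A AG.
- move=> A AG AT; have /implyP/(_ AT)/existsP[x /andP[xA GxA]] := forall_inP GS A AG.
  by exists x.
- by apply/forall_inP=> A AG; apply/forall_inP=> B; apply: GI.
- apply/forall_inP=> A AG; apply/implyP=> AT; have [x xA GxA] := GS A AG AT.
  by apply/existsP; exists x; rewrite xA.
Qed.

Section ConvexGeometry.
Variables (X : finType) (G : {set {set X}}).
Hypothesis convG : convex_geometry G.
Implicit Types A B M : {set X}.

Lemma convex_geometryI : {in G &, forall A B, A :&: B \in G}.
Proof. by case/convex_geometryP: convG. Qed.

Lemma convex_geometryT : setT \in G.
Proof.
have [_ G0 _ GS] := convex_geometryP G convG.
case: (@arg_maxnP _ set0 [in G] (fun A => #|A|)) => //= A AG Amax.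
have [<-//|/(GS A AG)[x xA /Amax]] := eqVneq A setT.
by rewrite cardsU1 xA ltnn.
Qed.

Lemma conv_hull_closed A : conv_hull G A \in G.
Proof.
apply: (big_ind (fun B => B \in G)) => [||B /andP[]//].
  exact: convex_geometryT.
exact: convex_geometryI.
Qed.

(** Enlarge A one element at a time, up to the moment when an element of M is
    added for the first time: B is the stage just before, chosen as a largest
    closed set containing A with the same trace on M. *)
Lemma convex_geometry_step A M : A \in G -> ~~ (M \subset A) ->
  exists B y, [/\ B \in G, A \subset B, B :&: M = A :&: M,
                  y \in M :\: A & y |: B \in G].
Proof.
move=> AG MA; have [_ _ _ GS] := convex_geometryP G convG.
pose p := [pred B | [&& B \in G, A \subset B & B :&: M == A :&: M]].
have pA : p A by rewrite /= AG subxx eqxx.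
case: (@arg_maxnP _ A p (fun B => #|B|)) => //= B /and3P[BG AB /eqP BM] Bmax.
have BT : B != setT.
  apply: contraNneq MA => BT; apply/setIidPr.
  by rewrite -BM BT setTI.
have [y yB yBG] := GS B BG BT; exists B, y; split=> //.
have yM : y \in M.
  apply/negPn/negP => yM; have := Bmax (y |: B); rewrite yBG /=.
  rewrite (subset_trans AB (subsetUr _ _)) setIUl BM.
  have -> : [set y] :&: M = set0 by apply/disjoint_setI0; rewrite disjoints1.
  by rewrite set0U eqxx cardsU1 yB ltnn => /(_ isT).
by rewrite inE yM andbT; apply: contra yB; apply: (subsetP AB).
Qed.

(** For a closed set, being extreme is being removable: the hull of A :\ x lies
    between A :\ x and A. *)
Lemma extremeE A x : A \in G -> (x \in extreme G A) = (x \in A) && (A :\ x \in G).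
Proof.
move=> AG; rewrite inE; case xA: (x \in A) => //=; apply/idP/idP => [xh|AxG].
  suff <- : conv_hull G (A :\ x) = A :\ x.
    exact: conv_hull_closed.
  apply/eqP; rewrite eqEsubset; apply/andP; split.
    rewrite subsetD1 xh andbT; apply: bigcap_inf.
    by rewrite AG subsetDl.
  by apply/bigcapsP=> B /andP[].
apply/negP=> /bigcapP/(_ (A :\ x)); rewrite AxG subxx => /(_ isT).
by rewrite !inE eqxx.
Qed.

Definition trace (P : pred X) : {set {set {x | P x}}} :=
  [set [set y : {x | P x} | val y \in A] | A : {set X} in G].

(** The extension axiom for a trace is [convex_geometry_step]: steps outside P
    leave the trace unchanged. *)
Lemma trace_convex (P : pred X) (x0 : X) : P x0 -> convex_geometry (trace P).
Proof.
move=> Px0; have [_ G0 GI _] := convex_geometryP G convG; apply/convex_geometryP; split.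
- by apply/card_gt0P; exists (exist _ x0 Px0).
- by apply/imsetP; exists set0 => //; apply/setP=> y; rewrite !inE.
- move=> _ _ /imsetP[A AG ->] /imsetP[B BG ->]; apply/imsetP; exists (A :&: B).
    exact: GI.
  by apply/setP=> y; rewrite !inE.
move=> _ /imsetP[A AG ->] AT; have PA : ~~ ([set x | P x] \subset A).
  apply: contra AT => /subsetP PA; apply/eqP/setP=> y.
  by rewrite !inE PA // inE (valP y).
have [B [y [BG AB BP yP yBG]]] := convex_geometry_step AG PA.
move: yP; rewrite !inE => /andP[yA Py]; exists (exist _ y Py); rewrite ?inE //.
apply/imsetP; exists (y |: B) => //; apply/setP=> z; rewrite !inE -val_eqE /=.
congr (_ || _); have /setP/(_ (val z)) := BP.
by rewrite !inE (valP z) !andbT.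
Qed.

(** The order attached to G is x <= y iff x is in the hull of y. It is
    antisymmetric since a maximal chain of closed sets separates any two
    points. When G is stable under union, an ideal, being the union of the hulls
    of its elements, is closed. *)
Lemma is_ordinalP :
  is_ordinal G <-> forall A B, A \in G -> B \in G -> A :|: B \in G.
Proof.
have [_ G0 _ _] := convex_geometryP G convG.
have idealP (le : rel X) A :
    reflect (forall x y, le x y -> y \in A -> x \in A)
            [forall x, forall y, le x y && (y \in A) ==> (x \in A)].
  apply: (iffP forallP) => idA x => [y xy yA|].
    by have /implyP := forallP (idA x) y; apply; rewrite xy.
  by apply/forallP=> y; apply/implyP=> /andP[]; apply: idA.
split=> [[le _ ->] A B|GU].
  rewrite !inE => /idealP idA /idealP idB; apply/idealP=> x y xy; rewrite !inE.
  by case/orP=> [/(idA x y xy)|/(idB x y xy)] ->; rewrite ?orbT.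
pose le x y := x \in conv_hull G [set y].
have leP x y : reflect (forall A, A \in G -> y \in A -> x \in A) (le x y).
  apply: (iffP bigcapP) => xy A; first by move=> AG yA; apply: xy; rewrite AG sub1set.
  by case/andP=> AG; rewrite sub1set; apply: xy.
exists le.
  split=> [x|x y /andP[/leP xy /leP yx]|y x z /leP xy /leP yz]; first exact/leP.
    (* The first of x and y to enter a chain of closed sets enters without
       the other. *)
    have /(convex_geometry_step G0)[B [z [BG _ BM zM zBG]]] :
        ~~ ([set x; y] \subset set0).
      by apply/negP=> /subsetP/(_ x); rewrite !inE eqxx => /(_ isT).
    have [xB yB] : x \notin B /\ y \notin B.
      have := BM; rewrite set0I => /setP BM0; split; apply/negP => wB.
        by have := BM0 x; rewrite !inE wB eqxx.
      by have := BM0 y; rewrite !inE wB eqxx orbT.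
    move: zM; rewrite !inE => /orP[]/eqP zE; rewrite zE in zBG.
      have := yx _ zBG (setU11 _ _).
      by rewrite !inE (negPf yB) orbF => /eqP.
    have := xy _ zBG (setU11 _ _).
    by rewrite !inE (negPf xB) orbF => /eqP.
  by apply/leP=> A AG zA; apply/xy/yz.
apply/setP=> A; rewrite inE; apply/idP/idealP => [AG x y /leP xy|idA].
  exact: xy.
have -> : A = \bigcup_(y in A) conv_hull G [set y].
  apply/setP=> x; apply/idP/bigcupP=> [xA|[y yA xy]].
    by exists x => //; apply/leP.
  exact: idA xy yA.
apply: (big_ind (fun B => B \in G)) => // y _; exact: conv_hull_closed.
Qed.

End ConvexGeometry.

Lemma isomorphic_convex (X Y : finType) (G : {set {set X}}) (H : {set {set Y}}) :
  isomorphic G H -> convex_geometry G -> convex_geometry H.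
Proof.
move=> /isomorphic_sym/isomorphicP[s [t sK tK] HG] /convex_geometryP[X0 G0 GI GS].
apply/convex_geometryP; split.
- by case/card_gt0P: X0 => x _; apply/card_gt0P; exists (s x).
- by rewrite HG preimset0.
- by move=> A B; rewrite !HG preimsetI; apply: GI.
move=> A; rewrite HG => AG AT.
have [|x xA xAG] := GS _ AG.
  apply: contraNneq AT => AT; apply/eqP/setP=> y; rewrite inE.
  by have /setP/(_ (t y)) := AT; rewrite !inE tK.
exists (s x); first by rewrite inE in xA.
rewrite HG preimsetU; suff -> : s @^-1: [set s x] = [set x] by [].
by apply/setP=> z; rewrite !inE (can_eq sK).
Qed.

Lemma isomorphic_ordinal (X Y : finType) (G : {set {set X}}) (H : {set {set Y}}) :
  convex_geometry G -> isomorphic G H -> is_ordinal G -> is_ordinal H.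
Proof.
move=> convG GH /(is_ordinalP convG) GU; apply/is_ordinalP.
  exact: isomorphic_convex GH convG.
have /isomorphicP[s _ HG] := isomorphic_sym GH.
by move=> A B; rewrite !HG preimsetU; apply: GU.
Qed.

Lemma isomorphic_resolvable (X Y : finType) (G : {set {set X}}) (H : {set {set Y}}) :
  isomorphic G H -> is_resolvable G -> is_resolvable H.
Proof.
move=> GH [B [F [GB [GF [cB cF B1 F1 iso]]]]]; exists B, F, GB, GF; split=> //.
exact: isomorphic_trans (isomorphic_sym GH) iso.
Qed.

(** * Resolutions and autonomous sets *)

(** M behaves like one point of a quotient geometry: a closed set meeting M may
    be filled up to all of M; one that does not contain M may be stripped of it;
    and where the point could be added to A, every closed trace on M could be
    added instead. *)
Definition autonomous (Z : finType) (G : {set {set Z}}) (M : {set Z}) : bool :=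
  [&& [forall A in G, (A :&: M != set0) ==> (A :|: M \in G)],
      [forall A in G, (M \subset A) || (A :\: M \in G)]
    & [forall A in G, (A :&: M == set0) && (A :|: M \in G) ==>
        [forall B in G, A :|: B :&: M \in G]]].

Lemma autonomousP (Z : finType) (G : {set {set Z}}) (M : {set Z}) :
  reflect
    [/\ forall A, A \in G -> A :&: M != set0 -> A :|: M \in G,
        forall A, A \in G -> ~~ (M \subset A) -> A :\: M \in G
      & forall A B, A \in G -> A :&: M = set0 -> A :|: M \in G -> B \in G ->
          A :|: B :&: M \in G]
    (autonomous G M).
Proof.
apply: (iffP and3P) => -[GU GD GM]; split.
- by move=> A AG; apply/implyP/(forall_inP GU).
- by move=> A AG; apply/implyP; rewrite implybE negbK; apply: (forall_inP GD).
- move=> A B AG A0 AU; have /implyP := forall_inP GM A AG.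
  by rewrite A0 eqxx AU => /(_ isT)/forall_inP; apply.
- by apply/forall_inP=> A AG; apply/implyP/GU.
- by apply/forall_inP=> A AG; case MA: (M \subset A) => //=; apply: GD; rewrite ?MA.
- apply/forall_inP=> A AG; apply/implyP=> /andP[/eqP A0 AU].
  by apply/forall_inP=> B; apply: GM.
Qed.

Lemma isomorphic_autonomous (X Y : finType) (G : {set {set X}})
    (H : {set {set Y}}) :
    isomorphic G H ->
  (exists2 M : {set Y}, 1 < #|M| < #|Y| & autonomous H M) ->
  (exists2 M : {set X}, 1 < #|M| < #|X| & autonomous G M).
Proof.
move=> /isomorphic_sym/isomorphicP[s [t sK tK] HG] [M Mcard].
case/autonomousP=> HU HD HM.
have GH A : (A \in G) = (t @^-1: A \in H).
  by rewrite HG; congr (_ \in G); apply/setP=> x; rewrite !inE sK.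
have tM : t @^-1: (s @^-1: M) = M by apply/setP=> x; rewrite !inE tK.
exists (s @^-1: M).
  rewrite -(imset_bij _ tK sK) card_imset; last exact: can_inj tK.
  by rewrite (bij_eq_card (Bijective sK tK)).
apply/autonomousP; split=> [A|A|A B].
- rewrite !GH preimsetU tM => AH A0; apply: HU => //.
  apply: contraNneq A0 => A0; apply/eqP/setP=> x.
  by have /setP/(_ (s x)) := A0; rewrite !inE sK.
- rewrite !GH preimsetD tM => AH A0; apply: HD => //.
  apply: contra A0 => /subsetP A0; apply/subsetP=> x.
  by rewrite inE => /A0; rewrite inE sK.
rewrite !GH !preimsetU !preimsetI tM => AH A0; apply: HM => //.
by rewrite -tM -preimsetI A0 preimset0.
Qed.

Section Resolution.
Variables (X : finType) (Y : X -> finType).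
Variables (GX : {set {set X}}) (GY : forall x, {set {set Y x}}).
Hypotheses (convX : convex_geometry GX) (convY : forall x, convex_geometry (GY x)).

Let Z := {x : X & Y x}.
Let GZ : {set {set Z}} := resolution GX GY.

(** By [extremeE], the third condition fills the fiber of x as soon as x cannot
    be removed from the projection. *)
Lemma resolutionP (A : {set Z}) :
  reflect
    [/\ tag @: A \in GX,
        forall x, x \in tag @: A -> [set y : Y x | Tagged Y y \in A] \in GY x
      & forall x, x \in tag @: A -> (tag @: A) :\ x \notin GX ->
          forall y : Y x, Tagged Y y \in A]
    (A \in GZ).
Proof.
rewrite inE; apply: (iffP and3P) => -[AX AY AF]; split=> //.
- exact/forall_inP.
- move=> x xA xAG; apply/forallP; apply: (forall_inP AF).
  by rewrite inE extremeE // (negPf xAG) andbF.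
- exact/forall_inP.
- apply/forall_inP=> x; rewrite inE extremeE // => /andP[xN xA].
  by apply/forallP/AF => //; rewrite xA in xN.
Qed.

(** Altering a closed set inside the fiber of x changes its projection at most
    by x, and a partially filled fiber sits over a removable x. *)
Lemma fiber_autonomous x : autonomous GZ [set z | tag z == x].
Proof.
set M := [set z | _].
have GXI := convex_geometryI convX.
have tagD (A : {set Z}) : tag @: (A :\: M) = (tag @: A) :\ x.
  apply/setP=> u; rewrite !inE; apply/imsetP/andP => [[z]|[ux /imsetP[z zA uE]]].
    by rewrite !inE => /andP[zx zA ->]; split=> //; apply: imset_f.
  by exists z => //; rewrite !inE -uE ux.
have tagU (A B : {set Z}) : B :&: M != set0 ->
    tag @: (A :|: B :&: M) = x |: tag @: A.
  case/set0Pn=> w /setIP[wB]; rewrite inE => /eqP wx.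
  apply/setP=> u; rewrite !inE imsetU inE orbC; congr (_ || _).
  apply/imsetP/eqP => [[z /setIP[_]]|->]; first by rewrite inE => /eqP zx ->.
  by exists w => //; rewrite !inE wB wx eqxx.
have notin_tag (A : {set Z}) : A :&: M = set0 -> x \notin tag @: A.
  move=> A0; apply/imsetP=> -[z zA xE].
  by have /setP/(_ z) := A0; rewrite !inE zA xE eqxx.
have fiberN (A : {set Z}) (B : {set Z}) u : u != x ->
    [set y : Y u | Tagged Y y \in A :|: B :&: M] = [set y : Y u | Tagged Y y \in A].
  by move=> ux; apply/setP=> y; rewrite !inE /= (negPf ux) andbF orbF.
apply/autonomousP; split.
- move=> A /resolutionP[AX AY AF] A0.
  have xA : x \in tag @: A.
    case/set0Pn: A0 => w /setIP[wA]; rewrite inE => /eqP <-; exact: imset_f.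
  have tagAM : tag @: (A :|: M) = tag @: A.
    rewrite -{1}[M]setIid tagU; first by apply/setUidPr; rewrite sub1set.
    by case/set0Pn: A0 => w /setIP[_ wM]; apply/set0Pn; exists w; rewrite setIid.
  apply/resolutionP; rewrite tagAM; split=> // u uA.
    have [ux|ux] := eqVneq u x.
      have -> : [set y : Y u | Tagged Y y \in A :|: M] = setT.
        by apply/setP=> y; rewrite !inE /= (introT eqP ux) orbT.
      exact: convex_geometryT.
    by have := fiberN A setT u ux; rewrite setTI => ->; apply: AY.
  by move=> uN y; rewrite inE AF.
- move=> A /resolutionP[AX AY AF] MA.
  have AxG : (tag @: A) :\ x \in GX.
    have [xA|xA] := boolP (x \in tag @: A); last first.
      suff -> : (tag @: A) :\ x = tag @: A by [].
      by apply/setDidPl; rewrite disjoint_sym disjoints1.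
    apply: contraR MA => xF; apply/subsetP=> -[u y]; rewrite inE /= => /eqP ux.
    by move: y; rewrite ux => y; apply: AF xA xF y.
  apply/resolutionP; rewrite tagD; split=> // u /setD1P[ux uA].
    suff -> : [set y : Y u | Tagged Y y \in A :\: M]
            = [set y : Y u | Tagged Y y \in A] by apply: AY.
    by apply/setP=> y; rewrite !inE /= ux.
  move=> uN y; rewrite !inE /= ux; apply: AF => //; apply: contra uN => uG.
  have -> : ((tag @: A) :\ x) :\ u = ((tag @: A) :\ u) :&: ((tag @: A) :\ x).
    by apply/setP=> v; rewrite !inE; case: (v == u); case: (v == x);
      rewrite //= ?andbF ?andbb.
  exact: GXI.
move=> A B AG A0 AMG BG.
have [B0|B0] := eqVneq (B :&: M) set0; first by rewrite B0 setU0.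
have M0 : M :&: M != set0.
  by rewrite setIid; apply: contraNneq B0 => ->; rewrite setI0.
have xA := notin_tag A A0.
have [AX AY AF] := resolutionP _ AG; have [BX BY BF] := resolutionP _ BG.
have := AMG; rewrite -{1}[M]setIid => /resolutionP; rewrite tagU // => -[UX UY UF].
apply/resolutionP; rewrite tagU //; split=> // u uA.
  have [ux|ux] := eqVneq u x.
    case: _ / (esym ux) uA => _.
    have -> : [set y : Y x | Tagged Y y \in A :|: B :&: M]
            = [set y : Y x | Tagged Y y \in B].
      apply/setP=> y; rewrite !inE eqxx andbT; case yA: (_ \in A) => //=.
      by case/negP: xA; apply/imsetP; exists (Tagged Y y).
    apply: BY; case/set0Pn: B0 => w /setIP[wB]; rewrite inE => /eqP <-.
    exact: imset_f.
  by rewrite fiberN //; apply: AY; move: uA; rewrite !inE (negPf ux).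
have [ux|ux] := eqVneq u x.
  (* Removing x leaves the projection of A, which is closed. *)
  by case: _ / (esym ux) => /negP[]; rewrite setU1K.
move=> uN y; have := UF u uA uN y; rewrite !inE /= (negPf ux) !andbF !orbF.
by [].
Qed.

End Resolution.

(** The quotient of Z by M: the point None stands for M and Some z for z outside
    M, so that [insub] is the projection. Closed sets of the quotient are images
    of closed sets, and each fiber carries the trace of G. *)
Section Collapse.
Variables (Z : finType) (G : {set {set Z}}) (M : {set Z}).
Hypotheses (convG : convex_geometry G) (autM : autonomous G M).
Hypotheses (M_gt1 : 1 < #|M|) (M_lt : #|M| < #|Z|).

Let X : finType := option {z | z \notin M}.
Let p (z : Z) : X := insub z.
Let Y (x : X) : finType := {z | p z == x}.
Let GX : {set {set X}} := [set p @: A | A : {set Z} in G].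
Let GY (x : X) : {set {set Y x}} := trace G (fun z => p z == x).

Let pN z : (p z == None) = (z \in M).
Proof. by rewrite /p; case: insubP => [u /negPf->|/negPn->]. Qed.

Let pS z u : (p z == Some u) = (z == val u).
Proof.
rewrite /p; case: insubP => [v zM <-|/negPn zM] /=.
  by apply/eqP/eqP=> [[->]|/val_inj->].
by apply/esym/negP=> /eqP zu; rewrite zu (negPf (valP u)) in zM.
Qed.

Let imN (A : {set Z}) : (None \in p @: A) = (A :&: M != set0).
Proof.
apply/imsetP/set0Pn => -[z].
  by move=> zA /esym/eqP; rewrite pN => zM; exists z; rewrite inE zA.
by case/setIP=> zA zM; exists z => //; apply/esym/eqP; rewrite pN.
Qed.

Let imS (A : {set Z}) u : (Some u \in p @: A) = (val u \in A).
Proof.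
apply/imsetP/idP => [[z zA /esym/eqP]|uA]; first by rewrite pS => /eqP<-.
by exists (val u) => //; apply/esym/eqP; rewrite pS.
Qed.

Let p_surj x : exists z, p z == x.
Proof.
case: x => [u|]; first by exists (val u); rewrite pS.
have /card_gt0P[z zM] : 0 < #|M| by apply: ltnW.
by exists z; rewrite pN.
Qed.

Let collapse_imU (A : {set Z}) : A :&: M != set0 -> p @: (A :|: M) = p @: A.
Proof.
move=> A0; apply/setP=> -[u|]; last first.
  by rewrite !imN A0 setIUl setIid setU_eq0 (negPf A0).
by rewrite !imS inE (negPf (valP u)) orbF.
Qed.

(** A closed set of the quotient containing the collapsed point is the image of
    a closed set containing all of M. *)
Let saturated B : B \in GX -> None \in B ->
  exists2 A, [/\ A \in G & M \subset A] & B = p @: A.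
Proof.
have [GU _ _] := autonomousP _ _ autM.
case/imsetP=> A AG ->; rewrite imN => A0; exists (A :|: M).
  by split; [apply: GU | apply: subsetUr].
by rewrite collapse_imU.
Qed.

Let convex_base : convex_geometry GX.
Proof.
have [Z0 G0 GI GS] := convex_geometryP _ convG.
have [GU GD GM] := autonomousP _ _ autM.
apply/convex_geometryP; split.
- by apply/card_gt0P; exists None.
- by apply/imsetP; exists set0; rewrite ?imset0.
- suff capG B C : B \in GX -> C \in GX -> (None \in B -> None \in C) -> B :&: C \in GX.
    move=> B C BG CG; case CN: (None \in C); first by apply: capG => // _; rewrite CN.
    by rewrite setIC; apply: capG => //; rewrite CN.
  move=> BG CG BC; case BN: (None \in B).
    have CN := BC BN; have [A [AG MA] BE] := saturated BG BN.
    have [D [DG MD] CE] := saturated CG CN.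
    apply/imsetP; exists (A :&: D); first exact: GI.
    rewrite BE CE; apply/setP=> -[u|]; rewrite inE ?imS ?inE // !imN.
    have M0 : M != set0 by rewrite -card_gt0 ltnW.
    by rewrite -setIA (setIidPr MD) (setIidPr MA) M0.
  case/imsetP: BG BN => A AG BE BN; case/imsetP: CG => D DG CE.
  apply/imsetP; exists (A :&: D); first exact: GI.
  have A0 : A :&: M = set0 by apply/eqP; apply/negPn; rewrite -imN -BE BN.
  rewrite BE CE; apply/setP=> -[u|]; rewrite inE ?imS ?inE // !imN.
  by rewrite setIAC A0 set0I eqxx.
move=> B BG BT.
have [A AG BE] : exists2 A, A \in G & B = p @: A /\ (None \in B -> M \subset A).
  case BN: (None \in B); first by have [A []] := saturated BG BN; exists A.
  by case/imsetP: BG => A AG BE; exists A.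
case: BE => BE MA.
have [|z zA zAG] := GS A AG.
  apply: contraNneq BT => AT; apply/eqP/setP=> x; rewrite BE AT inE.
  by have [z /eqP <-] := p_surj x; apply: imset_f.
exists (p z); last first.
  by apply/imsetP; exists (z |: A); rewrite // imsetU1 BE.
apply/negP=> pzB; case pz: (p z) => [u|]; last first.
  move/eqP: pz zA; rewrite pN => zM; rewrite (subsetP (MA _)) //.
  by move: pzB; rewrite (eqP (_ : p z == None)) ?pN.
move: pzB; rewrite pz BE imS; move/eqP: pz; rewrite pS => /eqP <-.
by rewrite (negPf zA).
Qed.

Let convex_fiber x : convex_geometry (GY x).
Proof. by have [z pz] := p_surj x; apply: (trace_convex convG) pz. Qed.

Let split (z : Z) : {x : X & Y x} :=
  @existT X (fun x => Y x) (p z) (exist _ z (eqxx (p z))).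

Let splitE x (y : Y x) : split (val y) = Tagged (fun x => Y x) y.
Proof.
case: y => z zx /=; rewrite /split; have pzx := eqP zx; case: _ / pzx zx => zx.
by congr existT; apply: val_inj.
Qed.

Let split_bij : bijective split.
Proof.
by exists (fun w : {x : X & Y x} => val (tagged w)) => // -[x y]; apply: splitE.
Qed.

(** A set A satisfying the resolution conditions is closed by cases on its trace
    on M. If it is empty or full, A is a closed set or its saturation. If it is
    proper, None is removable from the image of A, so both A :\: M and
    (A :\: M) :|: M are closed, and the third autonomy condition lets any closed
    trace be added. *)
Lemma autonomous_resolvable : is_resolvable G.
Proof.
have [GU GD GM] := autonomousP _ _ autM.
have GI := convex_geometryI convG.
exists X, Y, GX, GY; split=> //.
- have /subsetPn[z _ zM] : ~~ ([set: Z] \subset M).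
    by apply/negP=> /subset_leq_card; rewrite cardsT leqNgt M_lt.
  rewrite card_option ltnS; apply/card_gt0P; by exists (exist _ z zM).
- exists None; rewrite card_sig; move: M_gt1.
  by rewrite (eq_card (fun z => esym (pN z))).
exists split; first exact: split_bij.
move=> A; have tagA : tag @: (split @: A) = p @: A.
  by rewrite -imset_comp; apply: eq_imset.
have fiberA x :
    [set y : Y x | Tagged (fun x => Y x) y \in split @: A] = [set y : Y x | val y \in A].
  apply/setP=> -[z zx]; rewrite !inE /=; apply/imsetP/idP => [[w wA wE]|zA].
    have -> // : z = w.
    by have /(congr1 (fun w : {x : X & Y x} => val (tagged w))) := wE.
  by exists z => //; rewrite -splitE.
apply/idP/resolutionP => //; rewrite tagA.
- move=> AG; split=> [|x _|x xA xG y].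
  + exact: imset_f.
  + by rewrite fiberA; apply: imset_f.
  suff : y \in [set y : Y x | Tagged (fun x => Y x) y \in split @: A] by rewrite inE.
  rewrite fiberA inE; case: x xA xG y => [u|] xA xG [z zx] /=.
    by move: zx; rewrite pS => /eqP->; rewrite -imS.
  move: zx; rewrite pN; apply: subsetP; apply: contraR xG => /(GD A AG) DG.
  apply/imsetP; exists (A :\: M) => //; apply/setP=> -[u|].
    by rewrite !inE !imS inE (valP u).
  rewrite setD11 imN; suff -> : (A :\: M) :&: M = set0 by rewrite eqxx.
  by apply/setP=> w; rewrite !inE; case: (w \in M); rewrite ?andbF.
case=> pAG fibG fullA; case/imsetP: (pAG) => B BG pAB.
have eqM : A :\: M = B :\: M.
  apply/setP=> z; rewrite !inE; case zM: (z \in M) => //=.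
  have -> : z = val (exist (fun z => z \notin M) z (negbT zM)) by [].
  by rewrite -!imS pAB.
have AE : A = (A :\: M) :|: (A :&: M) by rewrite setUC setID.
have [AN|AN] := boolP (None \in p @: A); last first.
  have BN : None \notin p @: B by rewrite -pAB.
  move: AN BN; rewrite !imN !negbK => /eqP A0 /eqP B0.
  suff -> : A = B by []. 
  by rewrite AE eqM A0 -B0 setUC setID.
have B0 : B :&: M != set0 by rewrite -imN -pAB.
have BUG := GU B BG B0.
have BUE : B :|: M = (A :\: M) :|: M.
  by rewrite eqM; apply/setP=> z; rewrite !inE; case: (z \in M); rewrite ?orbT ?orbF.
have [/setIidPr AM|MA] := boolP (M \subset A); first by rewrite AE AM -BUE.
have [C CG pC] : exists2 C, C \in G & p @: A :\ None = p @: C.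
  apply/imsetP; apply: contraR MA => AnG; apply/subsetP=> z; rewrite -pN => zx.
  have : exist (fun z => p z == None) z zx \in
      [set y : Y None | Tagged (fun x => Y x) y \in split @: A].
    by rewrite inE; apply: fullA.
  by rewrite fiberA inE.
have CE : C = A :\: M.
  apply/setP=> z; rewrite inE; case zM: (z \in M) => /=.
    have : None \notin p @: C by rewrite -pC !inE.
    rewrite imN negbK => /eqP/setP/(_ z); by rewrite !inE zM andbT.
  have -> : z = val (exist (fun z => z \notin M) z (negbT zM)) by [].
  by rewrite -!imS -pC !inE.
have := fibG None AN; rewrite fiberA => /imsetP[D DG /setP AD].
rewrite AE (_ : A :&: M = D :&: M).
  apply: GM; rewrite -?BUE // -CE //; apply/setP=> w.
  by rewrite CE !inE; case: (w \in M); rewrite ?andbF.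
apply/setP=> z; rewrite !inE; case zM: (z \in M); rewrite ?andbF // !andbT.
move: zM; rewrite -pN => zx.
by have := AD (exist (fun z => p z == None) z zx); rewrite !inE.
Qed.

End Collapse.

Lemma is_resolvableP (Z : finType) (G : {set {set Z}}) :
  convex_geometry G ->
  (is_resolvable G <-> exists2 M : {set Z}, 1 < #|M| < #|Z| & autonomous G M).
Proof.
move=> convG; split=> [[X [Y [GX [GY [cX cY X1 [x Yx1] iso]]]]]|[M /andP[M1 MZ] aM]].
  apply: isomorphic_autonomous iso _.
  exists [set z | tag z == x]; last exact: fiber_autonomous.
  have cardF u : #|[set z : {x : X & Y x} | tag z == u]| = #|Y u|.
    pose f (y : Y u) : {x : X & Y x} := Tagged (fun x => Y x) y.
    have -> : [set z : {x : X & Y x} | tag z == u] = f @: setT.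
      apply/setP=> -[v y]; rewrite inE /=; apply/eqP/imsetP=> [vu|[w _ /(congr1 tag)]//].
      by move: y; rewrite vu => y; exists y.
    rewrite card_imset ?cardsT // => y z /eqP; rewrite /f eq_Tagged => /eqP.
    by [].
  rewrite cardF Yx1 /=.
  have [u ux] : exists u, u != x.
    apply/existsP; rewrite -negb_forall; apply/negP=> /forallP allx.
    move: X1; rewrite (@eq_card1 _ x) // => u; rewrite !inE.
    exact/esym/allx.
  have [y _] : exists y : Y u, true.
    by have [/card_gt0P[y _] _ _ _] := convex_geometryP _ (cY u); exists y.
  rewrite -(cardF x) -[X in _ < X]cardsT; apply: proper_card.
  rewrite properE subsetT; apply/subsetPn; exists (Tagged (fun x => Y x) y) => //.
  by rewrite inE.
exact: autonomous_resolvable aM M1 MZ.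
Qed.

(** * Affine geometries *)

Section Affine.
Import Order.TTheory GRing.Theory Num.Theory.
Local Open Scope ring_scope.
Variable R : realType.

(** The parameter is a real with bounds on the side, rather than an element of
    the type of reals in [0, 1], so that field arithmetic applies to it. *)
Definition in_segment d (a b c : 'rV[R]_d) : Prop :=
  exists2 t : R, 0 <= t <= 1 & c = t *: a + (1 - t) *: b.

Lemma convex_setE d (C : set (convex_lmodType 'rV[R]_d)) :
  convex_set C <-> forall a b c : 'rV[R]_d, in_segment a b c -> C a -> C b -> C c.
Proof.
split=> [convC a b c [t /andP[t0 t1] ->] Ca Cb | convC a b t].
  by have := convC a b (Itv01 t0 t1); rewrite !in_setE; apply.
rewrite !in_setE => Ca Cb; apply: convC Ca Cb; exists t%:num => //.
by apply/andP.
Qed.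

Lemma segment_convex d (a b : 'rV[R]_d) :
  @convex_set R 'rV[R]_d (in_segment a b).
Proof.
apply/convex_setE=> x y z [t /andP[t0 t1] ->] [u /andP[u0 u1] ->] [v /andP[v0 v1] ->].
exists (t * u + (1 - t) * v); first by apply/andP; split; nra.
by apply/rowP=> j; rewrite !mxE; ring.
Qed.

Lemma in_segmentl d (a b : 'rV[R]_d) : in_segment a b a.
Proof. by exists 1; rewrite ?ler01 ?lexx // subrr scale0r scale1r addr0. Qed.

Lemma in_segmentr d (a b : 'rV[R]_d) : in_segment a b b.
Proof. by exists 0; rewrite ?ler01 ?lexx // subr0 scale0r scale1r add0r. Qed.

Lemma in_segmentxx d (a c : 'rV[R]_d) : in_segment a a c -> c = a.
Proof. by case=> t _ ->; rewrite -scalerDl addrC subrK scale1r. Qed.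

(** Order a, e, c, b along the line: if e comes before c then c lies between e
    and b. *)
Lemma in_segment_inner d (a b c e : 'rV[R]_d) :
  in_segment a b c -> in_segment a c e -> in_segment e b c.
Proof.
case=> t /andP[t0 t1] cE [u /andP[u0 u1] eE].
have [D0|D0] := eqVneq (t + u - t * u) 0.
  exists 0; first by rewrite lexx ler01.
  have t00 : t = 0 by nra.
  by rewrite cE t00 !scale0r.
have Dgt : 0 < t + u - t * u by rewrite lt_def D0; nra.
exists (t / (t + u - t * u)).
  by apply/andP; split; rewrite ?divr_ge0 ?(ltW Dgt) // ler_pdivrMr // mul1r; nra.
by rewrite eE cE; apply/rowP=> j; rewrite !mxE; field.
Qed.

(** From e, the vectors to a, b, c would be pairwise opposite in direction, which
    is impossible for three nonzero vectors. *)
Lemma in_segment_tripod d (a b c e : 'rV[R]_d) : e != a -> e != b -> e != c ->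
  in_segment a b e -> in_segment a c e -> in_segment b c e -> False.
Proof.
move=> ea eb ec [t /andP[t0 t1] eab] [u /andP[u0 u1] eac] [v /andP[v0 v1] ebc].
have tp : 0 < t.
  by rewrite lt_def t0 andbT; apply: contraNneq eb => tE;
    rewrite eab tE subr0 scale0r scale1r add0r.
have up : 0 < u.
  by rewrite lt_def u0 andbT; apply: contraNneq ec => uE;
    rewrite eac uE subr0 scale0r scale1r add0r.
have vp : 0 < v.
  by rewrite lt_def v0 andbT; apply: contraNneq ec => vE;
    rewrite ebc vE subr0 scale0r scale1r add0r.
have ul : u < 1.
  by rewrite lt_def u1 andbT; apply: contraNneq ea => uE;
    rewrite eac -uE subrr scale0r scale1r addr0.
case/eqP: ec; apply/rowP=> j.
have := congr1 (fun w : 'rV_d => w 0 j) eab.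
have := congr1 (fun w : 'rV_d => w 0 j) eac.
have := congr1 (fun w : 'rV_d => w 0 j) ebc.
rewrite !mxE; move: (a 0 j) (b 0 j) (c 0 j) (e 0 j) => x y z w E1 E2 E3.
have F : (z - w) * (t * (1 - u) * v + (1 - t) * (1 - v) * u) = 0.
  transitivity (v * t * (u * x + (1 - u) * z - w)
     + u * (1 - t) * (v * y + (1 - v) * z - w)
     - u * v * (t * x + (1 - t) * y - w)); first by ring.
  by rewrite -E1 -E2 -E3 !subrr !mulr0 addr0 subr0.
have K : 0 < t * (1 - u) * v + (1 - t) * (1 - v) * u.
  by rewrite ltr_wpDr ?mulr_gt0 ?mulr_ge0 ?subr_ge0 ?subr_gt0.
by apply/eqP; rewrite eq_sym -subr_eq0; move/eqP: F; rewrite mulf_eq0 (gt_eqF K) orbF.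
Qed.

Definition between (X : finType) (G : {set {set X}}) (a b c : X) : bool :=
  [forall A in G, (a \in A) && (b \in A) ==> (c \in A)].

(** A segment is convex, so its trace is closed; this identifies [between], which
    is purely combinatorial, with geometric betweenness. *)
Lemma affine_between (X : finType) (G : {set {set X}}) : is_affine R G ->
  exists d (p : X -> 'rV[R]_d), injective p /\
    forall a b c, between G a b c <-> in_segment (p a) (p b) (p c).
Proof.
case=> d [P [_ [s sbij GP]]]; exists d, (val \o s); split.
  exact/inj_comp/bij_inj/sbij/val_inj.
move=> a b c; split=> [abc|].
  have [t sK tK] := sbij.
  pose C : set (convex_lmodType 'rV[R]_d) := in_segment (val (s a)) (val (s b)).
  pose S := [set q : P | val q \in C].
  have SG : s @^-1: S \in G.
    rewrite GP (imset_bij _ sK tK).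
    have -> : t @^-1: (s @^-1: S) = S by apply/setP=> q; rewrite !inE tK.
    by rewrite inE; apply/asboolP; exists C => //; apply: segment_convex.
  have /implyP := forall_inP abc _ SG; rewrite !inE => H; apply: set_mem; apply: H.
  by rewrite !mem_set //; [exact: in_segmentr | exact: in_segmentl].
move=> abc; apply/forall_inP=> A; rewrite GP inE => /asboolP[C convC sA].
have inA x : (x \in A) = (val (s x) \in C).
  by rewrite -(mem_imset _ _ (bij_inj sbij)) sA inE.
rewrite !inA; apply/implyP=> /andP[/set_mem aC /set_mem bC].
by apply/mem_set; move/convex_setE: convC; apply; eauto.
Qed.

Definition segment_axioms (X : finType) (G : {set {set X}}) : bool :=
  [&& [forall a, forall c, between G a a c ==> (c == a)],
      [forall a, forall b, forall c, forall e,
         [&& e != a, e != b & e != c] ==>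
         ~~ [&& between G a b e, between G a c e & between G b c e]]
    & [forall a, forall b, forall c, forall e,
         between G a b c && between G a c e ==> between G e b c]].

Lemma affine_segment_axioms (X : finType) (G : {set {set X}}) :
  is_affine R G -> segment_axioms G.
Proof.
case/affine_between=> d [p [pinj btw]]; apply/and3P; split.
- apply/forallP=> a; apply/forallP=> c; apply/implyP=> /btw/in_segmentxx/pinj->.
  exact: eqxx.
- apply/forallP=> a; apply/forallP=> b; apply/forallP=> c; apply/forallP=> e.
  apply/implyP=> /and3P[ea eb ec]; apply/negP=> /and3P[/btw abe /btw ace /btw bce].
  by apply: in_segment_tripod abe ace bce; rewrite (inj_eq pinj).
- apply/forallP=> a; apply/forallP=> b; apply/forallP=> c; apply/forallP=> e.
  by apply/implyP=> /andP[/btw abc /btw ace]; apply/btw/(in_segment_inner abc).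
Qed.

Lemma isomorphic_affine (X Y : finType) (G : {set {set X}}) (H : {set {set Y}}) :
  isomorphic G H -> is_affine R G -> is_affine R H.
Proof.
move=> /isomorphic_sym HG [d [P [P0 GP]]]; exists d, P; split=> //.
exact: isomorphic_trans HG GP.
Qed.

(** A finite set of points is the trace of a convex set iff each of the remaining
    points can be separated from it by a convex set: intersect all convex sets
    that contain it. *)
Lemma affine_realization (X : finType) (G : {set {set X}}) d (p : X -> 'rV[R]_d) :
    (0 < #|X|)%N -> injective p ->
    (forall A, A \in G <-> forall x, x \notin A ->
       exists C : set 'rV[R]_d,
         [/\ @convex_set R 'rV[R]_d C, forall y, y \in A -> C (p y) & ~ C (p x)]) ->
  is_affine R G.
Proof.
move=> /card_gt0P[x0 _] pinj GE; pose P := [fset p x | x in X]%fset.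
have pP x : p x \in P by apply/imfsetP; exists x.
exists d, P; split; first by apply/fset0Pn; exists (p x0).
pose s x : P := [` pP x]%fset.
have sbij : bijective s.
  have sinj : injective s by move=> x y /(congr1 val)/pinj.
  have ssurj q : exists x, s x == q.
    have /imfsetP[x _ qE] := valP q; exists x; apply/eqP/val_inj; rewrite /= qE //.
  exists (fun q => xchoose (ssurj q)) => [x|q]; last exact/eqP/(xchooseP (ssurj q)).
  exact/sinj/eqP/(xchooseP (ssurj (s x))).
exists s => // A; rewrite inE; apply/idP/asboolP => [/GE sepA|[C convC sA]].
  (* The convex hull of the points of A. *)
  pose C : set (convex_lmodType 'rV[R]_d) := fun v => forall D : set 'rV[R]_d,
    @convex_set R 'rV[R]_d D -> (forall y, y \in A -> D (p y)) -> D v.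
  exists C.
    apply/convex_setE=> a b c abc Ca Cb D convD AD.
    by move/convex_setE: (convD); apply; [exact: abc | exact: Ca | exact: Cb].
  apply/setP=> q; have [t sK tK] := sbij; rewrite -(tK q) mem_imset; last exact: bij_inj.
  rewrite inE /=; apply/idP/idP => [xA|].
    by apply/mem_set => D _; apply.
  move/set_mem => xC; apply/negPn/negP=> /sepA[D [convD AD]]; apply.
  exact: xC.
apply/GE=> x; have inA y : (y \in A) = (p y \in C).
  by rewrite -(mem_imset _ _ (bij_inj sbij)) sA inE.
move=> xA; exists C; split=> // [y|].
  by rewrite inA => /set_mem.
by move/mem_set; rewrite -inA (negPf xA).
Qed.

Lemma halfspace_convex d (j : 'I_d) (e r : R) :
  @convex_set R 'rV[R]_d (fun v => e * v 0 j < r).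
Proof.
apply/convex_setE=> a b c [t /andP[t0 t1] ->] ar br; rewrite !mxE.
have -> : e * (t * a 0 j + (1 - t) * b 0 j)
        = r - (t * (r - e * a 0 j) + (1 - t) * (r - e * b 0 j)).
  by ring.
rewrite gtrBl; have [t2|t2] := leP t (1 / 2).
  by rewrite ltr_wpDl ?mulr_ge0 ?mulr_gt0 ?subr_gt0 ?subr_ge0 ?(ltW ar) //; lra.
by rewrite ltr_wpDr ?mulr_ge0 ?mulr_gt0 ?subr_gt0 ?subr_ge0 ?(ltW br) //; lra.
Qed.

Definition interval_geometry n : {set {set 'I_n}} :=
  [set A : {set 'I_n} | [forall i in A, forall k in A, forall j : 'I_n,
     (i <= j <= k)%N ==> (j \in A)]].

(** The point i is the number i: gaps are filled by convexity, and a point outside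
    an interval is cut off by a half-line. *)
Lemma interval_geometry_affine n : is_affine R (interval_geometry n.+1).
Proof.
pose p (i : 'I_n.+1) : 'rV[R]_1 := const_mx i%:R.
apply: (@affine_realization _ _ _ p); first by rewrite card_ord.
  move=> i j /(congr1 (fun v : 'rV[R]_1 => v 0 0)); rewrite !mxE => /eqP.
  by rewrite eqr_nat => /eqP/val_inj.
move=> A; split=> [|sepA]; last first.
  rewrite inE; apply/forall_inP=> i iA; apply/forall_inP=> k kA.
  apply/forallP=> j; apply/implyP=> /andP[ij jk]; apply/negPn/negP.
  case/sepA=> C [/convex_setE convC AC]; apply.
  apply: (convC (p i) (p k)); try exact: AC.
  have ijR : (i%:R : R) <= j%:R by rewrite ler_nat.
  have jkR : (j%:R : R) <= k%:R by rewrite ler_nat.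
  have [ik|ik] := eqVneq (k%:R : R) i%:R.
    exists 0; first by rewrite lexx ler01.
    by apply/rowP=> l; rewrite !mxE; lra.
  have ik0 : 0 < (k%:R : R) - i%:R.
    by rewrite subr_gt0 lt_def ik (le_trans ijR).
  (* The barycentric coordinates of j with respect to i and k. *)
  exists ((k%:R - j%:R) / (k%:R - i%:R)).
    by apply/andP; split; rewrite ?divr_ge0 ?(ltW ik0) ?ler_pdivrMr //; lra.
  by apply/rowP=> l; rewrite !mxE; field; rewrite subr_eq0.
rewrite inE => /forall_inP itvA x xA.
have sep (e : R) : (forall y, y \in A -> e * y%:R < e * x%:R) ->
  exists C : set 'rV[R]_1,
   [/\ @convex_set R 'rV[R]_1 C, forall y, y \in A -> C (p y) & ~ C (p x)].
  move=> ltA; exists (fun v => e * v 0 0 < e * x%:R); split.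
  - exact: halfspace_convex.
  - by move=> y yA; rewrite mxE; apply: ltA.
  - by rewrite mxE ltxx.
have neqx y : y \in A -> y != x by apply: contraTneq => ->.
have [|] := boolP [exists y in A, (x < y)%N].
  case/exists_inP=> y yA xy; apply: (sep (-1)) => z zA.
  rewrite !mulN1r ltrN2 ltr_nat ltnNge; apply/negP=> zx.
  have /forall_inP/(_ y yA)/forallP/(_ x)/implyP := itvA z zA.
  by rewrite zx ltnW // (negPf xA) => /(_ isT).
rewrite negb_exists_in => /forall_inP Ax; apply: (sep 1) => y yA.
rewrite !mul1r ltr_nat ltn_neqAle leqNgt Ax // andbT; exact: neqx.
Qed.

(** The vertices of a simplex together with an interior point, ord_max: the only
    condition on closed sets is that all vertices together force the interior
    point. *)
Definition simplex_geometry n : {set {set 'I_n.+1}} :=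
  [set A : {set 'I_n.+1} |
     (ord_max \in A) || [exists i, (i != ord_max) && (i \notin A)]].

(** The vertices are three times the unit vectors and the interior point is their
    centroid, which has all coordinates 1. If the vertex i is missing from A, the
    i-th coordinate is 0 on the vertices in A, 1 at the centroid and 3 at i, so
    it separates from A both i and, when it is not in A, the centroid. *)
Lemma triangle_geometry_affine : is_affine R (simplex_geometry 3).
Proof.
pose p (i : 'I_4) : 'rV[R]_3 :=
  \row_(j < 3) (if i == ord_max then 1 else if (i == j :> nat) then 3 else 0).
have pE (j : 'I_3) i :
    p i 0 j = if i == ord_max then 1 else if (i == j :> nat) then 3 else 0.
  by rewrite mxE.
have vertex (i : 'I_4) : i != ord_max -> exists j : 'I_3, i = j :> nat.
  move=> im; suff i3 : (i < 3)%N by exists (Ordinal i3).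
  by rewrite ltn_neqAle -ltnS ltn_ord andbT.
apply: (@affine_realization _ _ _ p); first by rewrite card_ord.
  have inj_vertex i k : i != ord_max -> p i = p k -> i = k.
    move=> im; have [j ij] := vertex i im => /(congr1 (fun v : 'rV_3 => v 0 j)).
    rewrite !pE (negPf im) ij eqxx; case: (k == ord_max).
      by move/eqP; rewrite (eqr_nat R 3 1).
    case: eqP => [kj _|_ /eqP]; last by rewrite pnatr_eq0.
    by apply: val_inj; rewrite /= ij kj.
  move=> i k ik; have [im|im] := eqVneq i ord_max; last exact: inj_vertex.
  have [km|km] := eqVneq k ord_max; first by rewrite im km.
  by rewrite (inj_vertex k i km (esym ik)).
move=> A; split=> [|sepA]; last first.
  rewrite inE; apply/orP; case mA: (ord_max \in A); [by left | right].
  apply: contraT; rewrite negb_exists => /forallP vA; exfalso.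
  have {}vA (j : 'I_3) : widen_ord (leqnSn 3) j \in A.
    have := vA (widen_ord (leqnSn 3) j); rewrite negb_and !negbK => /orP[/eqP|//].
    by move/(congr1 val) => /= jm; have := ltn_ord j; rewrite jm.
  have [C [/convex_setE convC AC]] := sepA _ (negbT mA); apply.
  pose v j := p (widen_ord (leqnSn 3) j).
  have Cv j : C (v j) by apply/AC/vA.
  (* The centroid is one third of the way from the midpoint of two vertices to
     the third. *)
  apply: (convC (v 0) ((1/2) *: v 1 + (1 - 1/2) *: v 2%:R)) => //.
    exists (1/3); first lra.
    apply/rowP; case=> -[|[|[|//]]] ?; rewrite !mxE /=; lra.
  by apply: convC (Cv _) (Cv _); exists (1/2); first lra.
rewrite inE => AG x xA.
have [i [im iA xi]] : exists i, [/\ i != ord_max, i \notin A & x = ord_max \/ x = i].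
  have [xm|xm] := eqVneq x ord_max; last by exists x; split=> //; right.
  rewrite -xm (negPf xA) /= in AG; have /existsP[i /andP[im iA]] := AG.
  by exists i; split=> //; [rewrite -xm | left].
have [j ij] := vertex i im.
exists (fun v => 1 * v 0 j < p x 0 j); split=> [|y yA|].
- exact: halfspace_convex.
- rewrite mul1r !pE -ij; case: xi => xE.
    rewrite xE eqxx; case: eqP => [ym|_]; first by case/negP: xA; rewrite xE -ym.
    by rewrite val_eqE; case: eqP => [yi|_]; [rewrite yi (negPf iA) in yA | lra].
  rewrite xE (negPf im) eqxx; case: eqP => [ym|_]; first lra.
  by rewrite val_eqE; case: eqP => [yi|_]; [rewrite yi (negPf iA) in yA | lra].
- by rewrite mul1r ltxx.
Qed.
End Affine.

(** * Bit sequences *)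

Definition bits_of n (A : {set 'I_n}) : bitseq := [seq i \in A | i <- enum 'I_n].

Definition family_of n (F : seq bitseq) : {set {set 'I_n}} :=
  [set A | bits_of A \in F].

Definition bmeet (a b : bitseq) : bitseq := [seq x.1 && x.2 | x <- zip a b].
Definition bjoin (a b : bitseq) : bitseq := [seq x.1 || x.2 | x <- zip a b].
Definition bdiff (a b : bitseq) : bitseq := [seq x.1 && ~~ x.2 | x <- zip a b].

Fixpoint bitseqs n : seq bitseq :=
  if n is m.+1 then map (cons false) (bitseqs m) ++ map (cons true) (bitseqs m)
  else [:: [::]].

Definition convexb n (F : seq bitseq) : bool :=
  [&& all (fun a => size a == n) F, nseq n false \in F,
      all (fun a => all (fun b => bmeet a b \in F) F) F
    & all (fun a => (a != nseq n true) ==>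
        has (fun i => ~~ nth false a i && (set_nth false a i true \in F))
            (iota 0 n)) F].

Definition union_closedb (F : seq bitseq) : bool :=
  all (fun a => all (fun b => bjoin a b \in F) F) F.

Definition autonomousb n (F : seq bitseq) (m : bitseq) : bool :=
  [&& all (fun a => (bmeet a m != nseq n false) ==> (bjoin a m \in F)) F,
      all (fun a => (bmeet m a == m) || (bdiff a m \in F)) F
    & all (fun a => (bmeet a m == nseq n false) && (bjoin a m \in F) ==>
        all (fun b => bjoin a (bmeet b m) \in F) F) F].

Definition resolvableb n (F : seq bitseq) : bool :=
  has (fun m => (1 < count id m < n) && autonomousb n F m) (bitseqs n).

Definition betweenb (F : seq bitseq) (a b c : nat) : bool :=
  all (fun m => nth false m a && nth false m b ==> nth false m c) F.

Definition segment_axiomsb n (F : seq bitseq) : bool :=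
  let I := iota 0 n in
  [&& all (fun a => all (fun c => betweenb F a a c ==> (c == a)) I) I,
      all (fun a => all (fun b => all (fun c => all (fun e =>
        [&& e != a, e != b & e != c] ==>
        ~~ [&& betweenb F a b e, betweenb F a c e & betweenb F b c e]) I) I) I) I
    & all (fun a => all (fun b => all (fun c => all (fun e =>
        betweenb F a b c && betweenb F a c e ==> betweenb F e b c) I) I) I) I].

(** The characteristic sequence of the preimage of m under p. *)
Definition permute (p : seq nat) (m : bitseq) : bitseq := [seq nth false m i | i <- p].

Definition isomorphicb n (F H : seq bitseq) : bool :=
  has (fun p => all (fun m => (m \in F) == (permute p m \in H)) (bitseqs n))
      (permutations (iota 0 n)).

Definition interval_bitseqs n : seq bitseq :=
  [seq m <- bitseqs n |
    all (fun i => nth false m i ==> all (fun k => nth false m k ==>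
      all (fun j => (i <= j <= k) ==> nth false m j) (iota 0 n)) (iota 0 n)) (iota 0 n)].

Definition simplex_bitseqs n : seq bitseq :=
  [seq m <- bitseqs n.+1 |
    nth false m n || has (fun i => (i != n) && ~~ nth false m i) (iota 0 n.+1)].

Lemma mem_bitseqs n m : (m \in bitseqs n) = (size m == n).
Proof.
elim: n m => [|n IHn] [|b m] //=; rewrite mem_cat.
  by apply/negP=> /orP[] /mapP[].
rewrite eqSS -IHn; apply/orP/idP=> [[] /mapP[a am [_ ->]] //|mm].
by case: b; [right | left]; apply: map_f.
Qed.

Section Bits.
Variable n : nat.
Implicit Types (A B : {set 'I_n}) (F H : seq bitseq) (m : bitseq).

Lemma size_bits A : size (bits_of A) = n.
Proof. by rewrite size_map size_enum_ord. Qed.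

Lemma nth_bits A (i : 'I_n) : nth false (bits_of A) i = (i \in A).
Proof. by rewrite (nth_map i) ?size_enum_ord // nth_ord_enum. Qed.

Lemma bits_inj : injective (@bits_of n).
Proof. by move=> A B AB; apply/setP=> i; rewrite -!nth_bits AB. Qed.

Lemma bits_surj m : size m = n -> exists A, bits_of A = m.
Proof.
move=> mn; exists [set i : 'I_n | nth false m i].
apply: (@eq_from_nth _ false); first by rewrite size_bits.
by rewrite size_bits => i i_n; rewrite (nth_bits _ (Ordinal i_n)) inE.
Qed.

Lemma bits_bitseqs A : bits_of A \in bitseqs n.
Proof. by rewrite mem_bitseqs size_bits. Qed.

Lemma bits0 : bits_of (set0 : {set 'I_n}) = nseq n false.
Proof.
apply: (@eq_from_nth _ false) => [|i]; rewrite size_bits ?size_nseq // => i_n.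
by rewrite (nth_bits _ (Ordinal i_n)) inE nth_nseq i_n.
Qed.

Lemma bitsT : bits_of (setT : {set 'I_n}) = nseq n true.
Proof.
apply: (@eq_from_nth _ false) => [|i]; rewrite size_bits ?size_nseq // => i_n.
by rewrite (nth_bits _ (Ordinal i_n)) inE nth_nseq i_n.
Qed.

Lemma bitsI A B : bits_of (A :&: B) = bmeet (bits_of A) (bits_of B).
Proof. by rewrite /bmeet zip_map -map_comp; apply: eq_map => i; rewrite /= inE. Qed.

Lemma bitsU A B : bits_of (A :|: B) = bjoin (bits_of A) (bits_of B).
Proof. by rewrite /bjoin zip_map -map_comp; apply: eq_map => i; rewrite /= inE. Qed.

Lemma bitsD A B : bits_of (A :\: B) = bdiff (bits_of A) (bits_of B).
Proof. by rewrite /bdiff zip_map -map_comp; apply: eq_map => i; rewrite /= inE andbC. Qed.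

Lemma bitsU1 (x : 'I_n) A : bits_of (x |: A) = set_nth false (bits_of A) x true.
Proof.
have sz : size (set_nth false (bits_of A) x true) = n.
  by rewrite size_set_nth size_bits; apply/maxn_idPr.
apply: (@eq_from_nth _ false); rewrite size_bits ?sz // => i i_n.
rewrite (nth_bits _ (Ordinal i_n)) nth_set_nth /= !inE -val_eqE /=.
by case: eqP => //= _; rewrite -(nth_bits A (Ordinal i_n)).
Qed.

Lemma count_bits A : count id (bits_of A) = #|A|.
Proof.
by rewrite count_map -sum1_count -sum1_card big_enum_cond /=; apply: eq_bigl.
Qed.

Lemma all_iota (P : pred 'I_n) (Q : pred nat) : (forall i : 'I_n, P i = Q i) ->
  [forall i, P i] = all Q (iota 0 n).
Proof.
move=> PQ; rewrite -val_enum_ord all_map; apply/forallP/allP => [Pi i _|Qi i].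
  by rewrite /= -PQ.
by rewrite PQ; apply: Qi; rewrite mem_enum.
Qed.

Lemma has_iota (P : pred 'I_n) (Q : pred nat) : (forall i : 'I_n, P i = Q i) ->
  [exists i, P i] = has Q (iota 0 n).
Proof.
move=> PQ; rewrite -val_enum_ord has_map; apply/existsP/hasP => [[i Pi]|[i _ Qi]].
  by exists i; rewrite ?mem_enum //= -PQ.
by exists i; rewrite PQ.
Qed.

Definition wf F := all (fun a => size a == n) F.

Lemma mem_family_of F A : (A \in family_of n F) = (bits_of A \in F).
Proof. by rewrite inE. Qed.

Lemma all_family_of F (P : pred {set 'I_n}) (Q : pred bitseq) : wf F ->
  (forall A, P A = Q (bits_of A)) -> [forall A in family_of n F, P A] = all Q F.
Proof.
move=> wfF PQ; apply/forall_inP/allP => [PA m mF|QF A].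
  have [A Am] := bits_surj (eqP (allP wfF m mF)).
  by rewrite -Am -PQ; apply: PA; rewrite mem_family_of Am.
by rewrite mem_family_of PQ; apply: QF.
Qed.

Lemma convexbP F : 0 < n -> wf F -> convex_geometry (family_of n F) = convexb n F.
Proof.
move=> n0 wfF; rewrite /convex_geometry /convexb -/(wf F) wfF card_ord n0 /=.
rewrite mem_family_of bits0; congr [&& _, _ & _].
  apply: all_family_of => // A; apply: all_family_of => // B.
  by rewrite mem_family_of bitsI.
apply: all_family_of => // A; rewrite -bitsT (inj_eq bits_inj); congr (_ ==> _).
by apply: has_iota => i; rewrite nth_bits mem_family_of bitsU1.
Qed.

Lemma union_closedbP F : 0 < n -> convexb n F ->
  is_ordinal (family_of n F) <-> union_closedb F.
Proof.
move=> n0 convF; have /and4P[wfF _ _ _] := convF.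
rewrite is_ordinalP ?convexbP //.
have <- : [forall A in family_of n F, forall B in family_of n F,
    A :|: B \in family_of n F] = union_closedb F.
  apply: all_family_of => // A; apply: all_family_of => // B.
  by rewrite mem_family_of bitsU.
split=> [FU|FU A B AF BF].
  by apply/forall_inP=> A AF; apply/forall_inP=> B; apply: FU.
exact: (forall_inP (forall_inP FU A AF)).
Qed.

Lemma autonomousbP F (M : {set 'I_n}) : wf F ->
  autonomous (family_of n F) M = autonomousb n F (bits_of M).
Proof.
move=> wfF; rewrite /autonomous /autonomousb; congr [&& _, _ & _].
- apply: all_family_of => // A.
  by rewrite -bitsI -bits0 (inj_eq bits_inj) mem_family_of bitsU.
- apply: all_family_of => // A.
  by rewrite -bitsI (inj_eq bits_inj) mem_family_of bitsD (sameP setIidPl eqP).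
- apply: all_family_of => // A.
  rewrite -bitsI -bits0 (inj_eq bits_inj) mem_family_of bitsU; congr (_ ==> _).
  by apply: all_family_of => // B; rewrite mem_family_of bitsU bitsI.
Qed.

Lemma resolvablebP F : 0 < n -> convexb n F ->
  is_resolvable (family_of n F) <-> resolvableb n F.
Proof.
move=> n0 convF; have /and4P[wfF _ _ _] := convF.
rewrite is_resolvableP ?convexbP //; split=> [[M Mn MF]|/hasP[m]].
  apply/hasP; exists (bits_of M); first exact: bits_bitseqs.
  by rewrite count_bits -autonomousbP // MF andbT; rewrite card_ord in Mn.
rewrite mem_bitseqs => /eqP/bits_surj[M <-]; rewrite count_bits -autonomousbP //.
by case/andP=> Mn MF; exists M; rewrite ?card_ord.
Qed.

Lemma segment_axiomsbP F : wf F ->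
  segment_axioms (family_of n F) = segment_axiomsb n F.
Proof.
move=> wfF.
have btw (a b c : 'I_n) : between (family_of n F) a b c = betweenb F a b c.
  by apply: all_family_of => // A; rewrite !nth_bits.
rewrite /segment_axioms /segment_axiomsb; congr [&& _, _ & _].
- by apply: all_iota => a; apply: all_iota => c; rewrite btw.
- apply: all_iota => a; apply: all_iota => b; apply: all_iota => c.
  by apply: all_iota => e; rewrite !btw.
- apply: all_iota => a; apply: all_iota => b; apply: all_iota => c.
  by apply: all_iota => e; rewrite !btw.
Qed.

(** A permutation of 'I_n is given by the list of its values, which is a
    permutation of [iota 0 n]. *)
Lemma isomorphicbP F H :
  reflect (isomorphic (family_of n F) (family_of n H)) (isomorphicb n F H).
Proof.
have permuteE (s : 'I_n -> 'I_n) A :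
    permute [seq val (s i) | i <- enum 'I_n] (bits_of A) = bits_of (s @^-1: A).
  by rewrite /permute -map_comp; apply: eq_map => i; rewrite /= nth_bits inE.
apply: (iffP hasP) => [[p]|/isomorphicP[s sbij FH]]; last first.
  exists [seq val (s i) | i <- enum 'I_n].
    rewrite mem_permutations; apply: uniq_perm; rewrite ?iota_uniq //.
      rewrite map_inj_uniq ?enum_uniq // => i j /val_inj; exact: bij_inj.
    move=> i; rewrite mem_iota /= add0n; apply/mapP/idP=> [[j _ ->]//|i_n].
    have [t sK tK] := sbij; exists (t (Ordinal i_n)); rewrite ?mem_enum //.
    by rewrite tK.
  apply/allP=> m; rewrite mem_bitseqs => /eqP/bits_surj[A <-].
  by rewrite permuteE -!mem_family_of FH.
rewrite mem_permutations => pn /allP pFH.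
have szp : size p = n by rewrite (perm_size pn) size_iota.
have p_lt (i : 'I_n) : nth 0 p i < n.
  have : nth 0 p i \in p by rewrite mem_nth // szp.
  by rewrite (perm_mem pn) mem_iota.
pose s i := Ordinal (p_lt i).
have pE : [seq val (s i) | i <- enum 'I_n] = p.
  apply: (@eq_from_nth _ 0); rewrite size_map size_enum_ord // => i i_n.
  by rewrite (nth_map (Ordinal i_n)) ?size_enum_ord // (nth_ord_enum _ (Ordinal i_n)).
apply/isomorphicP; exists s.
  apply: injF_bij => i j /(congr1 val) /= /eqP.
  rewrite nth_uniq ?szp // ?(perm_uniq pn) ?iota_uniq //.
  by move/eqP/val_inj.
move=> A; rewrite !mem_family_of -permuteE pE.
exact/eqP/pFH/bits_bitseqs.
Qed.

Lemma interval_bitseqsE : family_of n (interval_bitseqs n) = interval_geometry n.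
Proof.
apply/setP=> A; rewrite !inE mem_filter bits_bitseqs andbT; apply/esym.
apply: all_iota => i; rewrite nth_bits; congr (_ ==> _).
apply: all_iota => k; rewrite nth_bits; congr (_ ==> _).
by apply: all_iota => j; rewrite nth_bits.
Qed.

End Bits.

Lemma simplex_bitseqsE n : family_of n.+1 (simplex_bitseqs n) = simplex_geometry n.
Proof.
apply/setP=> A; rewrite !inE mem_filter bits_bitseqs andbT; apply/esym.
rewrite -(nth_bits A ord_max); congr (_ || _).
by apply: has_iota => i; rewrite nth_bits.
Qed.

(** * Enumeration *)

(** Backtracking search for the intersection-stable families that contain [acc]:
    a new set is accepted only if its intersections with the accepted sets are
    accepted or still undecided. Families that fail to be stable may survive this
    pruning; what matters is that no stable one is lost. *)
Fixpoint meet_families (acc todo : seq bitseq) : seq (seq bitseq) :=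
  if todo is m :: rest then
    meet_families acc rest ++
    (if all (fun a => bmeet a m \in m :: acc ++ rest) acc
     then meet_families (m :: acc) rest else [::])
  else [:: acc].

(** The initial segments {i | i < k} of 'I_n, for k <= n. *)
Definition chain n : seq bitseq :=
  [seq nseq k true ++ nseq (n - k) false | k <- iota 0 n.+1].

Definition chained_geometries n : seq (seq bitseq) :=
  [seq F <- meet_families (chain n) [seq m <- bitseqs n | m \notin chain n]
  | convexb n F].

Fixpoint representatives n (L : seq (seq bitseq)) : seq (seq bitseq) :=
  if L is F :: L' then
    let K := representatives n L' in
    if has (isomorphicb n F) K then K else F :: K
  else [::].

Definition classification n (L : seq (seq bitseq)) : Prop :=
  [/\ all (convexb n) L,
      pairwise (fun F H => ~~ isomorphicb n F H) L
    & forall G : {set {set 'I_n}}, convex_geometry G ->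
        exists2 F, F \in L & isomorphic G (family_of n F)].

(** Since P is invariant under isomorphism, it suffices to decide it on the
    representatives. *)
Lemma nb_classes_count n (L : seq (seq bitseq)) (P : {set {set 'I_n}} -> Prop)
    (Pb : pred (seq bitseq)) :
    0 < n -> classification n L ->
    (forall G H : {set {set 'I_n}},
       convex_geometry G -> isomorphic G H -> P G -> P H) ->
    (forall F, F \in L -> P (family_of n F) <-> Pb F) ->
  nb_classes n P = count Pb L.
Proof.
move=> n0 [convL distL fullL] Piso PL.
have convF F : F \in L -> convex_geometry (family_of n F).
  by move=> /(allP convL) convF; rewrite convexbP //; case/and4P: convF.
rewrite -size_filter -(size_map (family_of n)).
apply: nb_classesE.
- elim: L distL {convL fullL PL convF} => //= F L IHL /andP[FL /IHL uL].
  case: ifP => //= _; rewrite uL andbT; apply/mapP=> -[H].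
  rewrite mem_filter => /andP[_ HL] FH.
  by case/isomorphicbP: (allP FL _ HL); rewrite FH; apply: isomorphic_refl.
- move=> _ _ /mapP[F + ->] /mapP[H + ->]; rewrite !mem_filter.
  move=> /andP[_ FL] /andP[_ HL] FH; congr family_of.
  elim: L distL FL HL {convL fullL PL convF} => //= K L IHL /andP[KL dL].
  rewrite !inE => /orP[/eqP FK|FL] /orP[/eqP HK|HL]; first by rewrite FK.
  + by case/isomorphicbP: (allP KL _ HL); rewrite -FK.
  + by case/isomorphicbP: (allP KL _ FL); rewrite -HK; apply: isomorphic_sym.
  + exact: IHL.
- move=> _ /mapP[F + ->]; rewrite mem_filter => /andP[PbF FL].
  by split; [apply: convF | apply/PL].
- move=> G convG PG; have [F FL GF] := fullL G convG.
  exists (family_of n F) => //; apply: map_f; rewrite mem_filter FL andbT.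
  exact/PL/(Piso _ _ convG GF).
Qed.

Lemma meet_families_complete (P : pred bitseq) acc todo :
    (forall a b, P a -> P b -> P (bmeet a b)) ->
    all P acc -> (forall m, P m -> m \in acc ++ todo) ->
  exists2 F, F \in meet_families acc todo & F =i P.
Proof.
move=> PI; elim: todo acc => [|m rest IH] acc Pacc Ptodo /=.
  exists acc; first by rewrite inE.
  move=> a; apply/idP/idP=> [|Pa]; first exact: (allP Pacc).
  by have := Ptodo a Pa; rewrite cats0.
have [Pm|Pm] := boolP (P m).
  have [|a Pa|F F_in FP] := IH (m :: acc); first by rewrite /= Pm.
    by have := Ptodo a Pa; rewrite !mem_cat !inE; case: (a == m); rewrite ?orbT.
  exists F => //; rewrite mem_cat; case: ifP => [_|/negP[]]; first by rewrite F_in orbT.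
  apply/allP=> a /(allP Pacc) Pa; have := Ptodo _ (PI a m Pa Pm).
  by rewrite inE !mem_cat inE; case: (_ == m); rewrite ?orbT.
have [//|a Pa|F F_in FP] := IH acc.
  have := Ptodo a Pa; rewrite !mem_cat inE; case: eqP => // am.
  by rewrite -am Pa in Pm.
by exists F => //; rewrite mem_cat F_in.
Qed.

(** The search starts from the chain of initial segments, so it misses nothing
    that contains this chain. *)
Lemma chained_geometries_complete n (G : {set {set 'I_n}}) :
    convex_geometry G -> (forall k, [set i : 'I_n | i < k] \in G) ->
  exists2 F, F \in chained_geometries n & family_of n F = G.
Proof.
move=> convG chainG.
have [X0 _ GI _] := convex_geometryP _ convG; rewrite card_ord in X0.
pose P : pred bitseq := mem [seq bits_of A | A in G].
have PE (A : {set 'I_n}) : P (bits_of A) = (A \in G).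
  apply/imageP/idP=> [[B BG /bits_inj->]//|AG]; by exists A.
have Pbits m : P m -> exists2 A, A \in G & m = bits_of A by move/imageP.
have bits_chain (k : nat) : k <= n ->
    bits_of [set i : 'I_n | i < k] = nseq k true ++ nseq (n - k) false.
  move=> kn; apply: (@eq_from_nth _ false).
    by rewrite size_bits size_cat !size_nseq subnKC.
  rewrite size_bits => i i_n; rewrite (nth_bits _ (Ordinal i_n)) inE /=.
  rewrite nth_cat size_nseq !nth_nseq; case: ltnP => //.
  by case: ifP.
have [||m Pm|F Fmeet FP] := @meet_families_complete P (chain n)
    [seq m <- bitseqs n | m \notin chain n].
- by move=> _ _ /Pbits[A AG ->] /Pbits[B BG ->]; rewrite -bitsI PE GI.
- apply/allP=> _ /mapP[k + ->]; rewrite mem_iota ltnS => /andP[_ kn].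
  by rewrite -bits_chain // PE.
- have [A _ ->] := Pbits m Pm; rewrite mem_cat mem_filter bits_bitseqs andbT.
  by case: (_ \in chain n).
have FG : family_of n F = G by apply/setP=> A; rewrite mem_family_of FP -PE.
exists F => //; rewrite mem_filter Fmeet andbT -convexbP ?FG //.
by apply/allP=> m; rewrite FP => /Pbits[A _ ->]; rewrite size_bits.
Qed.

(** Iterating the extension axiom from the empty set adds all elements in some
    order w, every prefix of which is closed. *)
Lemma shelling n (G : {set {set 'I_n}}) : convex_geometry G ->
  exists w : seq 'I_n, [/\ uniq w, size w = n
    & forall k, [set x in take k w] \in G].
Proof.
case/convex_geometryP=> _ G0 _ GS.
suff build k : k <= n -> exists w : seq 'I_n, [/\ uniq w, size w = k
    & forall j, [set x in take j w] \in G] by exact: build.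
elim: k => [_|k IHk k_n].
  have nil0 : [set x in [::]] = set0 :> {set 'I_n}.
    by apply/setP=> x; rewrite !inE.
  by exists [::]; split=> // j; rewrite /= nil0.
have [w [uw sw wG]] := IHk (ltnW k_n).
have AG : [set x in w] \in G by rewrite -(take_size w).
have [|x xA xAG] := GS _ AG.
  apply: contraTneq k_n => AT; rewrite -leqNgt -sw -(card_uniqP uw).
  by rewrite -[X in X <= _]card_ord -cardsT -AT cardsE.
rewrite inE in xA; exists (rcons w x); rewrite rcons_uniq xA size_rcons sw.
split=> // j; rewrite -cats1 take_cat; case: ifP => // _.
case: (j - size w) => [|i] /=; first by rewrite cats0.
suff -> : [set y in w ++ [:: x]] = x |: [set y in w] by [].
by apply/setP=> y; rewrite !inE mem_cat inE orbC.
Qed.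

(** Relabel each element by its position in a shelling. *)
Lemma chained_relabelling n (G : {set {set 'I_n}}) : convex_geometry G ->
  exists2 H : {set {set 'I_n}}, isomorphic G H
    & forall k, [set i : 'I_n | i < k] \in H.
Proof.
case/shelling=> w [uw sw wG].
pose s (i : 'I_n) := nth i w i.
have sE (i j : 'I_n) : s i = nth j w i by apply: set_nth_default; rewrite sw.
have sbij : bijective s.
  apply: injF_bij => i j; rewrite (sE i i) (sE j i) => /eqP.
  by rewrite nth_uniq ?sw // => /eqP/val_inj.
exists [set A : {set 'I_n} | s @: A \in G].
  by apply: isomorphic_sym; exists s => // A; rewrite inE.
move=> k; rewrite inE; suff -> : s @: [set i : 'I_n | i < k] = [set x in take k w] by [].
apply/setP=> x; rewrite inE; apply/imsetP/idP=> [[i + ->]|].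
  rewrite inE => ik; rewrite /s -(nth_take _ ik) mem_nth // size_take sw.
  by case: (ltnP k n) => // _; apply: ltn_ord.
move=> xw; have := xw; rewrite -index_mem size_take sw => ix.
have ixn : index x (take k w) < n.
  by apply: leq_trans ix _; case: (ltnP k n) => // /ltnW.
exists (Ordinal ixn); first by rewrite inE; apply: leq_trans ix _; case: (ltnP k n).
rewrite (sE _ x) /= -(@nth_take k) ?nth_index //.
by apply: leq_trans ix _; case: (ltnP k n).
Qed.

Lemma representativesP n (L : seq (seq bitseq)) :
  [/\ {subset representatives n L <= L},
      pairwise (fun F H => ~~ isomorphicb n F H) (representatives n L)
    & forall F, F \in L -> exists2 H, H \in representatives n L
        & isomorphic (family_of n F) (family_of n H)].
Proof.
elim: L => //= F L [subL distL fullL]; case: ifP => [/hasP[H HL FH]|newF].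
  split=> // [K KL|K]; first by rewrite inE subL ?orbT.
  rewrite inE => /orP[/eqP->|]; last exact: fullL.
  by exists H => //; apply/isomorphicbP.
split=> [K| |K].
- by rewrite !inE => /orP[->//|/subL->]; rewrite orbT.
- by rewrite /= distL andbT all_predC newF.
rewrite inE => /orP[/eqP->|/fullL[H HL KH]].
  by exists F; [rewrite mem_head | apply: isomorphic_refl].
by exists H => //; rewrite inE HL orbT.
Qed.

Lemma classificationP n : classification n (representatives n (chained_geometries n)).
Proof.
have [subL distL fullL] := representativesP n (chained_geometries n).
split=> // [|G convG].
  by apply/allP=> F /subL; rewrite mem_filter => /andP[].
have [H GH chainH] := chained_relabelling convG.
have [F FL FH] := chained_geometries_complete (isomorphic_convex GH convG) chainH.
have [K KL FK] := fullL F FL; exists K => //.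
by apply: isomorphic_trans GH _; rewrite -FH.
Qed.

(** * The census *)

Definition census3 (L : seq (seq bitseq)) : bool :=
  [&& size L == 6,
      count (fun F => ~~ resolvableb 3 F && ~~ union_closedb F) L == 1
    & count (fun F => resolvableb 3 F && union_closedb F) L == 5].

Definition census4 (L : seq (seq bitseq)) : bool :=
  [&& size L == 34,
      count (fun F => ~~ resolvableb 4 F) L == 12,
      count (fun F => ~~ resolvableb 4 F && union_closedb F) L == 1,
      count (fun F => ~~ resolvableb 4 F && segment_axiomsb 4 F) L == 2
    & all (fun F => ~~ resolvableb 4 F && segment_axiomsb 4 F ==>
        isomorphicb 4 (interval_bitseqs 4) F
        || isomorphicb 4 (simplex_bitseqs 3) F) L].

Lemma exists_census3 : exists2 L, classification 3 L & census3 L.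
Proof.
exists (representatives 3 (chained_geometries 3)); first exact: classificationP.
(* The evaluation takes place once, in the kernel, when the proof is closed. *)
vm_cast_no_check (erefl true).
Qed.

Lemma exists_census4 : exists2 L, classification 4 L & census4 L.
Proof.
exists (representatives 4 (chained_geometries 4)); first exact: classificationP.
(* The evaluation takes place once, in the kernel, when the proof is closed. *)
vm_cast_no_check (erefl true).
Qed.

Theorem proposition5p1 (R : realType) :
  [/\ nb_classes 3 (fun _ => True) = 6,
      nb_classes 3 (fun G => is_primitive G /\ ~ is_ordinal G) = 1
    & nb_classes 3 (fun G => is_resolvable G /\ is_ordinal G) = 5] /\
  [/\ nb_classes 4 (fun _ => True) = 34,
      nb_classes 4 (fun G => is_primitive G) = 12,
      nb_classes 4 (fun G => is_primitive G /\ is_ordinal G) = 1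
    & nb_classes 4 (fun G => is_primitive G /\ is_affine R G) = 2].
Proof.
have resI n (G H : {set {set 'I_n}}) :
    isomorphic G H -> is_resolvable G <-> is_resolvable H.
  by move=> GH; split; apply: isomorphic_resolvable => //; apply: isomorphic_sym.
have ordI n (G H : {set {set 'I_n}}) :
    convex_geometry G -> isomorphic G H -> is_ordinal G <-> is_ordinal H.
  move=> cG GH; split; apply: isomorphic_ordinal => //; last exact: isomorphic_sym.
  exact: isomorphic_convex GH cG.
have affI n (G H : {set {set 'I_n}}) :
    isomorphic G H -> is_affine R G <-> is_affine R H.
  by move=> GH; split; apply: isomorphic_affine => //; apply: isomorphic_sym.
split.
  have [L clL /and3P[/eqP countT /eqP countP /eqP countO]] := exists_census3.
  have convL F : F \in L -> convexb 3 F by case: clL => /allP + _ _; apply.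
  have resL F : F \in L -> is_resolvable (family_of 3 F) <-> resolvableb 3 F.
    by move/convL/resolvablebP; apply.
  have ordL F : F \in L -> is_ordinal (family_of 3 F) <-> union_closedb F.
    by move/convL/union_closedbP; apply.
  split.
  - by rewrite -[RHS]countT -count_predT; apply: nb_classes_count.
  - rewrite -[RHS]countP; apply: nb_classes_count => // [G H cG GH|F FL].
      by rewrite /is_primitive (resI _ _ _ GH) (ordI _ _ _ cG GH).
    rewrite /is_primitive resL // ordL //.
    by split=> [[/negP-> /negP->]|/andP[/negP ? /negP ?]].
  - rewrite -[RHS]countO; apply: nb_classes_count => // [G H cG GH|F FL].
      by rewrite (resI _ _ _ GH) (ordI _ _ _ cG GH).
    by rewrite resL // ordL //; split=> [[-> ->]|/andP].
have [L clL /and5P[/eqP countT /eqP countP /eqP countO /eqP countA affL]] :=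
  exists_census4.
have convL F : F \in L -> convexb 4 F by case: clL => /allP + _ _; apply.
have resL F : F \in L -> is_resolvable (family_of 4 F) <-> resolvableb 4 F.
  by move/convL/resolvablebP; apply.
have ordL F : F \in L -> is_ordinal (family_of 4 F) <-> union_closedb F.
  by move/convL/union_closedbP; apply.
have primL F : F \in L -> is_primitive (family_of 4 F) <-> ~~ resolvableb 4 F.
  by move=> FL; rewrite /is_primitive resL //; split=> /negP.
split.
- by rewrite -[RHS]countT -count_predT; apply: nb_classes_count.
- rewrite -[RHS]countP; apply: nb_classes_count => // G H cG GH.
  by rewrite /is_primitive (resI _ _ _ GH).
- rewrite -[RHS]countO; apply: nb_classes_count => // [G H cG GH|F FL].
    by rewrite /is_primitive (resI _ _ _ GH) (ordI _ _ _ cG GH).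
  by rewrite primL // ordL //; split=> [[-> ->]|/andP].
- rewrite -[RHS]countA; apply: nb_classes_count => // [G H cG GH|F FL].
    by rewrite /is_primitive (resI _ _ _ GH) (affI _ _ _ GH).
  rewrite primL //; split=> [[primF affF]|/[dup] /andP[primF _] pF].
    rewrite primF -segment_axiomsbP; first exact: affine_segment_axioms affF.
    by have /and4P[] := convL F FL.
  split=> //; have /implyP/(_ pF)/orP[] := allP affL F FL => /isomorphicbP.
    by rewrite interval_bitseqsE => /isomorphic_affine;
      apply; apply: interval_geometry_affine.
  by rewrite simplex_bitseqsE => /isomorphic_affine;
      apply; apply: triangle_geometry_affine.
Qed.
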